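(* Let $(\epsilon(n))_{n \ge 1}$ be a sequence of real numbers with $\epsilon(n) \to 0$ as $n \to \infty$. Then there exist $n_0$ and subgroups $H_n < S_n$ for all $n \ge n_0$ such that $|H_n| \ge (n!)^{\epsilon(n)}$ for all $n \ge n_0$ and the family $(S_n, H_n)_{n \ge n_0}$ is indistinguishable.
   Context: For a finite group $G$, let $\mathrm{Irr}(G)$ be its set of complex irreducible characters and $d_\chi=\chi(e)$. For $H \le G$ let $D_H = \frac{1}{|G|}\sum_{\chi \in \mathrm{Irr}(G)} d_\chi \big|\sum_{h \in H, h \neq e}\chi(h)\big|$ (the $L_1$ distance between the distributions $P_H(\chi)=\frac{d_\chi}{|G|}\sum_{h\in H}\chi(h)$ and $P_{\{e\}}$ on $\mathrm{Irr}(G)$ produced by weak quantum Fourier sampling). A family $(G_i,H_i)_{i \in I}$ with $H_i \le G_i$, $I$ an infinite set of positive integers and $|G_i| \to \infty$, is called distinguishable if there is a constant $c>0$ such that $D_{H_i} \ge (\log|G_i|)^{-c}$ for all sufficiently large $i \in I$, and indistinguishable otherwise. $S_n$ is the symmetric group on $\{1,\ldots,n\}$, $|S_n| = n!$. *)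

(* Defs.v *)
From HB Require Import structures.
From mathcomp Require Import all_boot all_order all_algebra all_fingroup all_solvable all_field all_character.
From mathcomp Require Import all_classical all_reals all_analysis.
Set Implicit Arguments. Unset Strict Implicit. Unset Printing Implicit Defensive.
Import Order.TTheory GRing.Theory Num.Theory.
Local Open Scope ring_scope.

Definition Sn (n : nat) : {group {perm 'I_n}} := [set: {perm 'I_n}]%G.

Definition DH (n : nat) (H : {set {perm 'I_n}}) : algC :=
  (#|Sn n|%:R)^-1 *
  \sum_(i : Iirr (Sn n))
     'chi[Sn n]_i 1%g * `| \sum_(h in H | h != 1%g) 'chi[Sn n]_i h |.

(* Canonical embedding of the real part of an algebraic complex number into a
   real number type R, as the supremum of its rational lower cut. *)
Definition algC_to_real (R : realType) (x : algC) : R :=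
  sup [set (ratr q : R) | q in [set q : rat | (ratr q : algC) <= 'Re x]].

Definition distinguishable (R : realType) (I : pred nat)
    (H : forall n : nat, {set {perm 'I_n}}) : Prop :=
  exists c : R, 0 < c /\
    exists N : nat, forall n : nat, I n -> (N <= n)%N ->
      powR (ln (#|Sn n|%:R : R)) (- c) <= algC_to_real R (DH (H n)).

Definition indistinguishable (R : realType) (I : pred nat)
    (H : forall n : nat, {set {perm 'I_n}}) : Prop :=
  ~ distinguishable R I H.

(* Main.v *)
Require Import Defs.
From HB Require Import structures.
From mathcomp Require Import all_boot all_order all_algebra all_fingroup all_solvable all_field all_character.
From mathcomp Require Import all_classical all_reals all_analysis.
From mathcomp Require Import ring lra zify.
Import Order.TTheory GRing.Theory Num.Theory numFieldNormedType.Exports.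
Local Open Scope ring_scope.

(** Cauchy-Schwarz and column orthogonality give
    [D_H <= \sum_(h in H, h <> 1) |h^G|^(-1/2)], so it suffices to find a large
    [H] whose nontrivial elements lie in very large classes.  Let [H] be [S_m]
    acting diagonally on [k] copies of ['I_m] inside ['I_n], with [m = n / 2k].
    An element moving [s] points of ['I_m] moves [ks] points of ['I_n] and has
    at least [(n/2)^(ks/3)] conjugates, while at most [m^s] elements of [S_m]
    move [s] points; hence [D_H] is at most a power [n^(-p)] with [p] growing
    linearly in [k].  On the other hand [m! >= (n!)^(1/O(k))], so for each fixed
    [k] the size requirement holds for all large [n].  Letting [k] tend to
    infinity slowly with [n] makes [D_H] superpolynomially small. *)

(** * Bounding [DH] by conjugacy class sizes *)

(* Cauchy-Schwarz in the form [2 d |chi g| v <= d^2 + v^2 |chi g|^2], avoiding roots. *)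
Lemma sum_irr1_norm_le {gT : finGroupType} {G : {group gT}} {g : gT} {v : nat} :
  g \in G -> (0 < v)%N -> (v ^ 2 <= #|(g ^: G)%g|)%N ->
  (#|G|%:R)^-1 * \sum_(i : Iirr G) 'chi_i 1%g * `|'chi_i g| <= v%:R^-1 :> algC.
Proof.
move=> gG v0 hv.
have G0 : (0 : algC) < #|G|%:R by rewrite ltr0n cardG_gt0.
have V0 : (0 : algC) < v%:R by rewrite ltr0n.
have sq1 : \sum_(i : Iirr G) ('chi_i 1%g) ^+ 2 = #|G|%:R :> algC.
  exact: irr_sum_square.
have sqg : \sum_(i : Iirr G) `|'chi_i g| ^+ 2 = #|('C_G[g])%g|%:R :> algC.
  have := second_orthogonality_relation g gG; rewrite class_refl mulr1n => <-.
  by apply: eq_bigr => i _; rewrite normCK.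
have hC : (v%:R ^+ 2 * #|('C_G[g])%g|%:R : algC) <= #|G|%:R.
  rewrite -natrX -natrM ler_nat.
  have <- := Lagrange (subcent1_sub g G).
  by rewrite index_cent1 mulnC leq_mul2l hv orbT.
rewrite ler_pdivrMl // ler_pdivlMr //.
suff hs : \sum_(i : Iirr G) 'chi_i 1%g * `|'chi_i g| * v%:R *+ 2 <=
          #|G|%:R + v%:R ^+ 2 * #|('C_G[g])%g|%:R :> algC.
  rewrite -(ler_pMn2r (isT : (0 < 2)%N)) mulr_suml -sumrMnl.
  by apply: le_trans hs _; rewrite mulr2n lerD2l.
rewrite -sq1 -sqg mulr_sumr -big_split /=; apply: ler_sum => i _.
have r1 : 'chi_i 1%g \is Num.real by rewrite ger0_real // char1_ge0 // irr_char.
have r2 : `|'chi_i g| * v%:R \is Num.real by rewrite rpredM ?normr_real ?realn.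
have := real_leif_mean_square_scaled r1 r2 => -[+ _].
by rewrite mulrA exprMn [v%:R ^+ 2 * _]mulrC.
Qed.

Lemma DH_le_sum (n : nat) (H : {set {perm 'I_n}}) :
  DH H <= \sum_(g in H | g != 1%g) (#|Sn n|%:R)^-1 *
            \sum_(i : Iirr (Sn n)) 'chi_i 1%g * `|'chi_i g|.
Proof.
rewrite /DH -mulr_sumr exchange_big /= ler_wpM2l ?invr_ge0 ?ler0n //.
apply: ler_sum => i _; rewrite -mulr_sumr ler_wpM2l ?ler_norm_sum //.
by rewrite char1_ge0 // irr_char.
Qed.

Lemma DH_ge0 (n : nat) (H : {set {perm 'I_n}}) : 0 <= DH H.
Proof.
rewrite /DH mulr_ge0 ?invr_ge0 ?ler0n // sumr_ge0 // => i _.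
by rewrite mulr_ge0 // char1_ge0 // irr_char.
Qed.

(** * Class sizes in symmetric groups *)

Section PermClass.
Context {T : finType}.
Implicit Types (A B : {set T}) (g h : {perm T}).

Lemma perm_on_group_set A : group_set [set g : {perm T} | perm_on A g].
Proof.
apply/group_setP; split; first by rewrite inE perm_on1.
by move=> x y; rewrite !inE; apply: perm_onM.
Qed.

(* A permutation fixing [B] pointwise and commuting with [g] also fixes [g @: B],
   so the orbit of [g] under [Sym (~: B)] already has index at least
   [(n - b)! / (n - 2b)!]. *)
Lemma class_perm_ge g B : [disjoint B & g @: B] ->
  ((#|T| - 2 * #|B|) ^ #|B| <= #|(g ^: [set: {perm T}])%g|)%N.
Proof.
move=> dB.
pose K := Group (perm_on_group_set (~: B)).
have memK x : (x \in K) = perm_on (~: B) x by rewrite [LHS]finset.in_set.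
have cK : #|K| = (#|T| - #|B|)`!%N.
  by rewrite cardsE card_perm cardsCs finset.setCK.
have cgB : #|g @: B| = #|B| by rewrite card_imset //; apply: perm_inj.
have cU : #|B :|: g @: B| = (2 * #|B|)%N.
  by rewrite mul2n -addnn -{2}cgB; apply/eqP; rewrite (leq_card_setU B (g @: B)).2.
have cC : (#|('C_K[g])%g| <= (#|T| - 2 * #|B|)`!)%N.
  rewrite -cU -[X in (X - _)%N](cardsC (B :|: g @: B)) addKn -card_perm.
  apply: subset_leq_card; apply/fintype.subsetP => x /finset.setIP[].
  rewrite memK => xB /cent1P xg; rewrite unfold_in.
  apply/fintype.subsetP => i; rewrite !inE; apply: contraNN => /orP[iB|].
    by rewrite (out_perm xB) // !inE iB.
  case/imsetP => j jB ->; have := congr1 (fun p : {perm T} => p j) xg.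
  by rewrite !permM [x j](out_perm xB) ?inE ?jB // => <-.
have sub : (#|(g ^: K)%g| <= #|(g ^: [set: {perm T}])%g|)%N.
  by rewrite subset_leq_card // classS // subsetT.
apply: leq_trans sub; rewrite -index_cent1.
have := Lagrange (subcent1_sub g K); rewrite cK => L.
have hB : (2 * #|B| <= #|T|)%N by rewrite -cU max_card.
move: L; have -> : (#|T| - #|B| = #|T| - 2 * #|B| + #|B|)%N by lia.
set f := (#|T| - 2 * #|B|)%N => L.
have f1 : (0 < f`!)%N by apply: fact_gt0.
(* The quotient [(f + b)! / f!] is a product of [b] factors larger than [f]. *)
have fb b : (f ^ b * f`! <= (f + b)`!)%N.
  elim: b => [|b IH]; first by rewrite expn0 mul1n addn0.
  rewrite addnS factS expnS -mulnA leq_mul //; lia.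
rewrite -(leq_pmul2r f1); apply: leq_trans (fb _) _.
by rewrite -L mulnC leq_mul.
Qed.

(* By maximality of [B], every moved point lies in [B], [g @: B] or [g @^-1: B]. *)
Lemma disjoint_displaced g : exists2 B : {set T}, [disjoint B & g @: B] &
  (#|[set i | g i != i]| <= 3 * #|B|)%N.
Proof.
have [B /maxsetP[dB mB]] : {B | maxset [pred B : {set T} | [disjoint B & g @: B]] B}.
  by apply: ex_maxset; exists finset.set0; rewrite /= -finset.setI_eq0 finset.set0I.
exists B => //; rewrite /= in dB mB.
have cgB : #|g @: B| = #|B| by rewrite card_imset //; apply: perm_inj.
have cgB' : #|g @^-1: B| = #|B|.
  by rewrite -(can2_imset_pre B (permKV g) (permK g)) card_imset //; apply: perm_inj.
suff /subset_leq_card h : [set i | g i != i] \subset B :|: g @: B :|: g @^-1: B.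
  apply: leq_trans h _; apply: leq_trans (leq_card_setU _ _) _.
  apply: leq_trans (leq_add (leq_card_setU _ _) (leqnn _)) _.
  by rewrite cgB cgB'; lia.
apply/fintype.subsetP => i; rewrite !inE => gi; apply: contraT.
rewrite !negb_or => /andP[/andP[iB igB] giB].
(* Otherwise [i |: B] would still be disjoint from its image, against maximality. *)
case/negP: (iB); rewrite -(mB (i |: B)) ?finset.setU11 ?finset.subsetU1 //.
rewrite -finset.setI_eq0 finset.imsetU1; apply/eqP/setP => j; rewrite !inE.
apply/negbTE/negP => /andP[/orP[/eqP->|jB] /orP[/eqP e|jg]].
- by rewrite -e eqxx in gi.
- by rewrite jg in igB.
- by rewrite -e jB in giB.
- by move: dB; rewrite disjoint_sym => /pred0P/(_ j); rewrite /= jB jg.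
Qed.

End PermClass.

(** * Weighted counting of permutations by support *)

Lemma fact_le_expn {a t : nat} : (a <= t)%N -> (a`! <= t ^ a)%N.
Proof.
elim: a => [//|a IH] lt; rewrite factS expnS leq_mul ?IH //.
exact: ltnW.
Qed.

(** Group the permutations by support: at most [#|A|! <= #|T| ^ #|A|] of them have support [A].
    Expanding the power over subsets of [T] gives the bound, the subtracted 1 being the term of the
    empty support. *)
Lemma sum_exprn_support_le {F : numDomainType} {T : finType} {w : F} : 0 <= w ->
  \sum_(h : {perm T} | h != 1%g) w ^+ #|[set i | h i != i]|
  <= (1 + #|T|%:R * w) ^+ #|T| - 1.
Proof.
move=> w0; set x := #|T|%:R * w.
have -> : (1 + x) ^+ #|T| - 1 = \sum_(A : {set T} | A != finset.set0) x ^+ #|A|.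
  rewrite -prodr_const [1 + x]addrC (bigA_distr 1 +%R) /=.
  rewrite (bigD1 finset.set0) //= [X in X - 1]addrC.
  rewrite [X in _ + X - 1]big1 => [|i _]; last by rewrite finset.in_set0.
  rewrite addrK; apply: eq_bigr => A _.
  by rewrite -big_mkcond /= prodr_const.
rewrite (partition_big (fun h : {perm T} => [set i | h i != i])
   (fun A => A != finset.set0)) /=; last first.
  move=> h; apply: contraNneq => s0; apply/eqP/permP => i; rewrite perm1.
  by apply/eqP; have := finset.in_set0 i; rewrite -s0 inE => /negbFE.
apply: ler_sum => A _.
rewrite (eq_bigr (fun=> w ^+ #|A|)) => [|h /andP[_ /eqP->] //].
rewrite sumr_const -mulr_natl /x exprMn ler_wpM2r ?exprn_ge0 // -natrX ler_nat.
apply: (@leq_trans (#|A|)`!).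
  rewrite -card_perm; apply: subset_leq_card; apply/fintype.subsetP => h.
  rewrite !unfold_in => /andP[_ /eqP<-].
  by apply/fintype.subsetP => i; rewrite !inE.
exact: fact_le_expn (max_card _).
Qed.

(** A converse to Bernoulli's inequality for small [x]: the slack in the inductive step is exactly
    [x * (1 - 2 * m * x)]. *)
Lemma expr1D_le {F : numDomainType} {x : F} {m : nat} : 0 <= x ->
  2 * m%:R * x <= 1 -> (1 + x) ^+ m <= 1 + 2 * m%:R * x.
Proof.
move=> x0; elim: m => [|m IH] h; first by rewrite expr0 mulr0 mul0r addr0.
have hm : 2 * m%:R * x <= 1.
  by apply: le_trans h; rewrite ler_wpM2r // ler_wpM2l ?ler_nat ?ler0n.
rewrite exprSr; apply: (@le_trans _ _ ((1 + 2 * m%:R * x) * (1 + x))).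
  by rewrite ler_wpM2r ?IH // addr_ge0 ?ler01.
rewrite -subr_ge0.
have -> : 1 + 2 * m.+1%:R * x - (1 + 2 * m%:R * x) * (1 + x) =
   x * (1 - 2 * m%:R * x) by rewrite -natr1; ring.
by rewrite mulr_ge0 // subr_ge0.
Qed.

(** * The symmetric group acting diagonally on disjoint copies *)

(** Let [h] act on the first coordinate within the image of [f], and fix every point outside that
    image. *)
Lemma diagonal_embedding {T K U : finType} {f : T * K -> U} : injective f ->
  exists phi : {perm T} -> {perm U}, {morph phi : x y / (x * y)%g} /\
    forall h a b, phi h (f (a, b)) = f (h a, b).
Proof.
move=> injf.
pose ext (h : {perm T}) u := if [pick p | f p == u] is Some p then f (h p.1, p.2) else u.
have extf h a b : ext h (f (a, b)) = f (h a, b).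
  rewrite /ext; case: pickP => [p /eqP/injf -> //|/(_ (a, b))]; by rewrite eqxx.
have extN h u : (forall p, f p != u) -> ext h u = u.
  by move=> hu; rewrite /ext; case: pickP => [p|//]; rewrite (negbTE (hu p)).
have extM g h u : ext h (ext g u) = ext (g * h)%g u.
  have [/existsP[[a b] /eqP <-]|/existsPn hu] := boolP [exists p, f p == u].
    by rewrite !extf permM.
  by rewrite !extN.
have ext1 u : ext 1%g u = u.
  have [/existsP[[a b] /eqP <-]|/existsPn hu] := boolP [exists p, f p == u].
    by rewrite !extf perm1.
  by rewrite !extN.
have extK h : cancel (ext h) (ext h^-1%g) by move=> u; rewrite extM mulgV ext1.
exists (fun h => perm (can_inj (extK h))); split => [g h|h a b]; last by rewrite permE extf.
by apply/permP => u; rewrite permM !permE extM.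
Qed.

Lemma exists_injection {T U : finType} : (#|T| <= #|U|)%N -> exists f : T -> U, injective f.
Proof.
move=> le; exists (fun t => enum_val (widen_ord le (enum_rank t))) => x y.
by move/enum_val_inj/(congr1 val) => /= /val_inj/enum_rank_inj.
Qed.

(** The number of copies is [6 * q]: a factor 3 is lost in passing from the support to a displaced
    set, and a factor 2 to the square in the character bound. An element of support [s] then has at
    least [(b ^ (q * s)) ^ 2] conjugates. *)
Lemma exists_diagonal_subgroup {n m q b : nat} : (0 < q)%N -> (0 < b)%N ->
  (b + 6 * q * m <= n)%N ->
  exists H : {group {perm 'I_n}}, #|H| = m`! /\
    DH H <= (1 + m%:R * (b%:R ^+ q)^-1) ^+ m - 1.
Proof.
move=> q0 b0 hn.
have [|f injf] := @exists_injection ('I_m * 'I_(6 * q))%type 'I_n.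
  by rewrite card_prod !card_ord; lia.
have [phi [phiM phif]] := diagonal_embedding injf.
have hq : (0 < 6 * q)%N by lia.
have injphi : injective phi.
  move=> h h' e; apply/permP => a.
  by have := phif h' a (Ordinal hq); rewrite -e phif => /injf[].
have phi1 : phi 1%g = 1%g by apply: (mulgI (phi 1%g)); rewrite -phiM !mulg1.
have gH : group_set (phi @: [set: {perm 'I_m}]).
  apply/group_setP; split; first by rewrite -phi1 imset_f // finset.in_setT.
  move=> x y /imsetP[h _ ->] /imsetP[h' _ ->].
  by rewrite -phiM imset_f // finset.in_setT.
exists (Group gH); split.
  by rewrite card_imset // cardsT card_Sn.
apply: le_trans (DH_le_sum _ _) _.
rewrite big_mkcondr big_imset /=; last by move=> x y _ _; apply: injphi.
rewrite -big_mkcondr /=.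
have w0 : (0 : algC) <= (b%:R ^+ q)^-1 by rewrite invr_ge0 exprn_ge0 ?ler0n.
have := @sum_exprn_support_le _ 'I_m _ w0; rewrite card_ord; apply: le_trans.
rewrite (eq_bigl (fun h : {perm 'I_m} => h != 1%g)) => [|h]; last first.
  by rewrite finset.in_setT /= -{1}phi1 (inj_eq injphi).
apply: ler_sum => h h1.
rewrite exprVn -exprM -natrX; apply: sum_irr1_norm_le; rewrite ?finset.in_setT ?expn_gt0 ?b0 //.
have [B0 dB0 sB0] := disjoint_displaced h.
pose B := f @: finset.setX B0 [set: 'I_(6 * q)].
have cB : #|B| = (#|B0| * (6 * q))%N.
  by rewrite card_imset // cardsX cardsT card_ord.
have dB : [disjoint B & phi h @: B].
  apply/pred0P => u /=; apply/negP => /andP[/imsetP[[a c]]].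
  rewrite finset.in_setX => /andP[/= aB _] ->{u} /imsetP[v /imsetP[[a' c']]].
  rewrite finset.in_setX => /andP[/= aB' _] ->{v}; rewrite phif => /injf[ea _].
  move: dB0 => /pred0P/(_ a); rewrite /= aB /= => /negP; apply.
  by rewrite ea imset_f.
(* Hence [2 * #|B| <= 6 * q * m], which leaves the base [n - 2 * #|B|] at least [b]. *)
have c2 : (2 * #|B0| <= m)%N.
  have cg : #|h @: B0| = #|B0| by rewrite card_imset //; apply: perm_inj.
  rewrite mul2n -addnn -{2}cg -[leqRHS]card_ord.
  by move/eqP: (leq_card_setU B0 (h @: B0)).2; rewrite dB0; move=> /eqP/eqP <-; exact: max_card.
apply: leq_trans (class_perm_ge _ _ dB).
rewrite card_ord cB -expnM.
apply: (@leq_trans (b ^ (#|B0| * (6 * q)))).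
  by rewrite leq_pexp2l //; nia.
have [->//|e0] := posnP (#|B0| * (6 * q)); rewrite leq_exp2r //; nia.
Qed.

(** * Order of the subgroup and choice of parameters *)

(** Pair the factor [i + 1] of [m!] with [m - i]: each product is at least [m]. *)
Lemma expn_le_fact_sqr (m : nat) : (m ^ m <= m`! ^ 2)%N.
Proof.
have e : (m`! = \prod_(i < m) i.+1)%N.
  by rewrite fact_prod big_add1 big_mkord.
rewrite expnS expn1 {1}e (reindex_inj rev_ord_inj) e -big_split /=.
rewrite -[leqLHS]/(m ^ m)%N -{2}[m]card_ord -prod_nat_const.
apply: leq_prod => i _; have := ltn_ord i; nia.
Qed.

(** The chain is [n ^ n <= (m ^ 2) ^ (k * m) = (m ^ m) ^ (2 * k) <= m! ^ (4 * k)]. *)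
Lemma expn_le_fact_expn {n m k : nat} : (0 < m)%N -> (n <= k * m)%N -> (n <= m ^ 2)%N ->
  (n ^ n <= m`! ^ (4 * k))%N.
Proof.
move=> m0 nk nm.
have [->|n0] := posnP n; first by rewrite expn0 expn_gt0 fact_gt0.
apply: (@leq_trans ((m ^ m) ^ (2 * k))).
  apply: (@leq_trans ((m ^ 2) ^ n)); first by rewrite leq_exp2r.
  by rewrite -!expnM leq_pexp2l //; nia.
have k0 : (0 < 2 * k)%N by nia.
have -> : (4 * k = 2 * (2 * k))%N by lia.
by rewrite [leqRHS]expnM leq_exp2r // expn_le_fact_sqr.
Qed.

Lemma exists_subgroup_small_DH (p : nat) : exists N Q : nat, (0 < Q)%N /\
  forall n, (N <= n)%N -> exists H : {group {perm 'I_n}},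
    [/\ H \proper Sn n, (n`! <= #|H| ^ Q)%N & DH H <= (n%:R ^+ p)^-1].
Proof.
(* In [b ^ q = b ^ 3 * (b ^ 2) ^ p], the first factor will absorb [2 * m * m] and the second
   [n ^ p]. *)
pose q := (2 * p + 3)%N.
(* The threshold turns [n <= 24 * q * m] into [n <= m ^ 2]. *)
exists ((24 * q) ^ 2)%N, (4 * (24 * q))%N; split=> [|n nN]; first by rewrite /q; lia.
(* With this [m] the copies fill at most half of ['I_n], leaving room for [b]. *)
pose m := (n %/ (12 * q))%N; pose b := (n %/ 2)%N.
have q3 : (3 <= q)%N by rewrite /q; lia.
have n6 : (72 * 72 <= n)%N by apply: leq_trans nN; rewrite expnS expn1 leq_mul //; lia.
have hm : (12 * q * m <= n)%N by rewrite mulnC leq_divM.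
have hm' : (n < 12 * q * m.+1)%N by rewrite mulnC ltn_ceil //; lia.
have m0 : (0 < m)%N by rewrite divn_gt0; nia.
have nk : (n <= 24 * q * m)%N by nia.
have nm : (n <= m ^ 2)%N.
  rewrite -(leq_pmul2l (_ : 0 < n)%N); last by lia.
  apply: (@leq_trans ((24 * q * m) ^ 2)); first by rewrite mulnn leq_exp2r.
  by rewrite expnMn leq_mul.
have b2 : (2 * b <= n < 2 * b + 2)%N by rewrite /b; lia.
have hmb : (6 * q * m <= b)%N by lia.
have [|||H [cH DHle]] := @exists_diagonal_subgroup n m q b; try lia.
exists H; split.
- rewrite finset.properEcard finset.subsetT cH cardsT card_Sn /=.
  by rewrite ltn_fact //; nia.
- by rewrite cH; apply: leq_trans (expn_le_fact_expn m0 nk nm); apply: fact_le_expn.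
apply: le_trans DHle _.
have B0 : (0 : algC) < b%:R ^+ q by rewrite exprn_gt0 // ltr0n; lia.
have N0 : (0 : algC) < n%:R ^+ p by rewrite exprn_gt0 // ltr0n; lia.
have key : (2 * m * m * n ^ p <= b ^ q)%N.
  have nb : (n <= b ^ 2)%N by nia.
  have -> : (b ^ q = b ^ 3 * (b ^ 2) ^ p)%N by rewrite -expnM -expnD; congr expn; rewrite /q; lia.
  apply: leq_mul; last by have [->//|p0] := posnP p; rewrite leq_exp2r.
  have mb : (m <= b)%N by nia.
  have -> : (b ^ 3 = b * b * b)%N by rewrite !expnS expn0 muln1 mulnA.
  by rewrite !leq_mul //; lia.
have keyC : 2 * m%:R * (m%:R * (b%:R ^+ q)^-1) <= (n%:R ^+ p)^-1 :> algC.
  rewrite -[leRHS]mul1r ler_pdivlMr // mulrA mulrAC ler_pdivrMr // mul1r.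
  by rewrite -!natrX -!natrM ler_nat.
have le1 : (n%:R ^+ p)^-1 <= 1 :> algC.
  by rewrite invf_le1 // exprn_ege1 // ler1n; lia.
rewrite lerBlDl; apply: le_trans (expr1D_le _ (le_trans keyC le1)) _.
  by rewrite mulr_ge0 ?ler0n // invr_ge0 ltW.
by rewrite lerD2l.
Qed.

(** * Transfer to the reals and asymptotics *)

(** The bound is rational so that it can be compared both in [algC] and in [R]; positivity of [x]
    puts 0 in the lower cut, so the supremum is over a nonempty set. *)
Lemma algC_to_real_le {R : realType} {x : algC} {r : rat} : 0 <= x -> x <= ratr r ->
  algC_to_real R x <= ratr r.
Proof.
move=> x0 xr; rewrite /algC_to_real (Creal_ReP _ (ger0_real x0)).
apply: ge_sup; first by exists (ratr 0); exists 0 => //=; rewrite rmorph0.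
move=> _ [s /= sx <-]; rewrite ler_rat -(ler_rat algC).
exact: le_trans xr.
Qed.

(** Eventually [eps n <= 1 / Q], and [n! <= #|H| ^ Q] then gives the required order. *)
Lemma exists_good_subgroup {R : realType} {eps : nat -> R} : (eps @ \oo --> 0)%classic ->
  forall p, exists N : nat, forall n, (N <= n)%N -> exists H : {group {perm 'I_n}},
    [/\ H \proper Sn n, powR (n`!)%:R (eps n) <= #|H|%:R & DH H <= (n%:R ^+ p)^-1].
Proof.
move=> heps p; have [N [Q [Q0 hN]]] := exists_subgroup_small_DH p.
have QR0 : (0 : R) < Q%:R^-1 by rewrite invr_gt0 ltr0n.
have /cvgrPdist_le/(_ _ QR0) [M _ hM] := heps.
exists (maxn N M) => n; rewrite geq_max => /andP[nN nM].
have [H [pH sH dH]] := hN n nN; exists H; split => //.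
have := hM n nM; rewrite /= sub0r normrN => /(le_trans (ler_norm _)) he.
have f1 : (1 : R) <= (n`!)%:R by rewrite ler1n fact_gt0.
apply: le_trans (ler_powR f1 he) _.
have -> : #|H|%:R = powR (#|H|%:R ^+ Q) Q%:R^-1 :> R.
  by rewrite -powR_mulrn ?ler0n // -powRrM divff ?powRr1 ?ler0n // pnatr_eq0 -lt0n.
apply: ge0_ler_powR; rewrite ?(ltW QR0) ?nnegrE ?exprn_ge0 ?ler0n //.
by rewrite -natrX ler_nat.
Qed.

Lemma ln_fact_le {R : realType} (n : nat) : ln (n`!)%:R <= n%:R ^+ 2 :> R.
Proof.
have [->|n0] := posnP n; first by rewrite fact0 ln1 expr0n.
have nR0 : (0 : R) < n%:R by rewrite ltr0n.
have fR0 : (0 : R) < (n`!)%:R by rewrite ltr0n fact_gt0.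
apply: (@le_trans _ _ (ln (n%:R ^+ n))).
  by rewrite ler_ln ?posrE ?exprn_gt0 // -natrX ler_nat fact_le_expn.
by rewrite lnXn // -[ln _ *+ _]mulr_natl expr2 ler_wpM2l ?ler0n // ltW // ln_sublinear.
Qed.

Lemma indistinguishable_small_DH {R : realType} {I : pred nat}
    {H : forall n, {set {perm 'I_n}}} :
  (forall N, exists n, (N <= n)%N /\ I n) ->
  (forall p : nat, exists N : nat, forall n, I n -> (N <= n)%N ->
     DH (H n) <= (n%:R ^+ p)^-1) ->
  indistinguishable R I H.
Proof.
move=> infI small [c [c0 [N hN]]].
(* With [e] an integer at least [c], [(ln n!) ^ c <= n ^ (2 * e) < n ^ (2 * e + 1)]; the extra 1
   makes the contradiction strict. *)
have [M hM] := small (2 * (Num.truncn c).+1).+1%N.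
have [n [nM nI]] := infI (maxn N M + 3)%N.
have cT : c <= (Num.truncn c).+1%:R by rewrite ltW // truncnS_gt.
have [nN nM'] : (N <= n /\ M <= n)%N by lia.
have hD := hM n nI nM'; have := hN n nI nN; apply/negP; rewrite -ltNge.
set e := (Num.truncn c).+1 in cT hD *.
have n3 : (3 <= n)%N by lia.
have nR1 : (1 : R) < n%:R by rewrite ltr1n; lia.
have nR0 : (0 : R) < n%:R by apply: lt_trans nR1.
have fl : (6%:R : R) <= (n`!)%:R by rewrite ler_nat (leq_trans _ (leq_fact n3)).
have L0 : 0 < ln ((n`!)%:R : R) by rewrite ln_gt0 //; lra.
have hr : algC_to_real R (DH (H n)) <= (n%:R ^+ (2 * e).+1)^-1.
  have := @algC_to_real_le R _ (n%:R ^+ (2 * e).+1)^-1 (DH_ge0 _ (H n)).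
  rewrite !fmorphV !rmorphXn /= !ratr_nat; exact.
rewrite cardsT card_Sn; apply: le_lt_trans hr _.
rewrite powRN ltf_pV2 ?posrE ?exprn_gt0 ?powR_gt0 //.
have n21 : (1 : R) <= n%:R ^+ 2 by rewrite exprn_ege1 // ltW.
apply: (@le_lt_trans _ _ (powR (n%:R ^+ 2) c)).
  by rewrite ge0_ler_powR ?nnegrE ?exprn_ge0 ?ln_fact_le ?(ltW c0) ?(ltW nR0) ?(ltW L0).
apply: (@le_lt_trans _ _ (powR (n%:R ^+ 2) e%:R)); first exact: ler_powR.
by rewrite powR_mulrn ?exprn_ge0 ?ltW // -exprM ltr_eXn2l.
Qed.

(** * One family serving all exponents *)

Local Open Scope classical_set_scope.

Theorem theorem4 (R : realType) (eps : nat -> R) (heps : eps @ \oo --> 0) :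
  exists (n0 : nat) (H : forall n : nat, {group {perm 'I_n}}),
    (forall n : nat, (n0 <= n)%N -> H n \proper Sn n) /\
    (forall n : nat, (n0 <= n)%N ->
        powR ((factorial n)%:R : R) (eps n) <= (#|H n|%:R : R)) /\
    indistinguishable R (fun n => (n0 <= n)%N) (fun n => (H n : {set {perm 'I_n}})).
Proof.
pose good p n (H : {group {perm 'I_n}}) :=
  [/\ H \proper Sn n, powR (n`!)%:R (eps n) <= #|H|%:R & DH H <= (n%:R ^+ p)^-1].
have ex p : exists N, forall n, (N <= n)%N -> exists H, good p n H.
  exact: exists_good_subgroup.
(* For each n take a subgroup that is good for the largest possible exponent p <= n. *)
have best n : exists H : {group {perm 'I_n}}, forall p, (p <= n)%N ->
    (exists H', good p n H') -> good p n H.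
  pose P p := (p <= n)%N && `[< exists H, good p n H >].
  have [exP|noP] := pselect (exists p, P p); last first.
    (* If no exponent up to [n] admits a good subgroup, any choice satisfies the claim vacuously. *)
    exists 1%G => p pn hp; case: noP; exists p; rewrite /P pn; exact/asboolP.
  have ubP p : P p -> (p <= n)%N by case/andP.
  case: (ex_maxnP exP ubP) => p /andP[pn /asboolP[H [H1 H2 H3]]] maxp.
  exists H => p' p'n hp'; split => //; apply: le_trans H3 _.
  have p'p : (p' <= p)%N by apply: maxp; rewrite /P p'n; exact/asboolP.
  have [n0|n0] := posnP n.
    by have -> : p' = p by lia.
  by rewrite lef_pV2 ?posrE ?exprn_gt0 ?ltr0n // ler_weXn2l // ler1n.
(* Exponent 0 already yields properness and the order bound, so [n0] does not depend on [p]. *)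
have [n0 hn0] := ex 0%N.
exists n0, (fun n => projT1 (cid (best n))).
have hgood p n : (p <= n)%N -> (exists H, good p n H) ->
    good p n (projT1 (cid (best n))).
  by case: (cid (best n)) => H /= hH; apply: hH.
split=> [n /hn0/(hgood 0%N n isT)[]//|]; split=> [n /hn0/(hgood 0%N n isT)[]//|].
apply: indistinguishable_small_DH => [N|p].
  by exists (maxn N n0); rewrite leq_maxl leq_maxr.
have [N hN] := ex p; exists (maxn N p) => n _; rewrite geq_max => /andP[nN pn].
by have [] := hgood p n pn (hN n nN).
Qed.
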